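(* Assume that Artin's conjecture does not hold at $s_0$, and let the characters be ordered as described in the context. Then the following are equivalent: (1) $s_0$ is a zero of $f_1$, $s_0$ is not a zero of any of $f_2,\ldots,f_r$, and $\ell_1\mid\ell_j$ for all $2\le j\le r$. (2) $I_{H(s_0)}=(0)$. Moreover, if one of these conditions holds, there exists $2\le q\le r$ such that $$\mathbb F[H(s_0)]=\mathbb F[x_1,\,x_1^{m_2}x_2,\ldots,x_1^{m_q}x_q,\,x_{q+1},\ldots,x_r],$$ where $m_j:=-\frac{\ell_j}{\ell_1}$ for $2\le j\le q$.
   Context: Let $K/\mathbb Q$ be a finite Galois extension with Galois group $G$, let $\chi_1,\ldots,\chi_r$ be the irreducible complex characters of $G$, and let $f_j(s)=L(s,\chi_j,K/\mathbb Q)$, $1\le j\le r$, be their Artin L-functions (meromorphic on $\mathbb C$). Fix $s_0\in\mathbb C\setminus\{1\}$ and let $\ell_j:=\operatorname{ord}_{s=s_0}f_j\in\mathbb Z$ be the order of $s_0$ as a zero of $f_j$ (negative if $f_j$ has a pole at $s_0$). Artin's conjecture at $s_0$ is the statement that $f_1,\ldots,f_r$ are all holomorphic at $s_0$, i.e. $\ell_j\ge0$ for all $j$. Let $\mathbb F$ be a field with $\mathbb C\subseteq\mathbb F\subseteq\mathcal M_{<1}$, where $\mathcal M_{<1}$ is the field of meromorphic functions on $\mathbb C$ of order $<1$. Let $H(s_0)$ be the set of $(a_1,\ldots,a_r)\in\mathbb N^r$ (with $0\in\mathbb N$) such that $L(s,a_1\chi_1+\cdots+a_r\chi_r)=f_1^{a_1}\cdots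 f_r^{a_r}$ is holomorphic at $s_0$, i.e. $H(s_0)=\{a\in\mathbb N^r: a_1\ell_1+\cdots+a_r\ell_r\ge 0\}$; it is a finitely generated semigroup. Let $\mathbb F[H(s_0)]\subseteq\mathbb F[x_1,\ldots,x_r]$ be the $\mathbb F$-subalgebra spanned by the monomials $x_1^{a_1}\cdots x_r^{a_r}$ with $(a_1,\ldots,a_r)\in H(s_0)$. Let $\{u_1,\ldots,u_m\}$ be the minimal set of monomials generating $\mathbb F[H(s_0)]$ as an $\mathbb F$-algebra. The toric ideal is $I_{H(s_0)}:=\ker\Phi$, where $\Phi:\mathbb F[t_1,\ldots,t_m]\to\mathbb F[H(s_0)]$ is the $\mathbb F$-algebra epimorphism with $\Phi(t_i)=u_i$. Ordering convention: when Artin's conjecture fails at $s_0$, some $\ell_j$ is negative and (since the Dedekind zeta function $\zeta_K=\prod_j f_j^{\chi_j(1)}$ is holomorphic at $s_0$) some $\ell_j$ is positive. The characters are then ordered so that, for some integers $1\le p<q\le r$, one has $\ell_1,\ldots,\ell_p>0$, $\ell_{p+1},\ldots,\ell_q<0$, and $\ell_{q+1}=\cdots=\ell_r=0$. *)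

(* Defs.v *)
(* The field of real numbers is an arbitrary [R : realType], and that of complex
   numbers is [R[i]].  Beware that some notations of [all_analysis], which is
   not imported here, are incompatible with those of [mpoly]. *)
From HB Require Import structures.
From mathcomp Require Import all_boot all_order all_algebra.
From mathcomp Require Import all_fingroup all_solvable all_field.
From mathcomp Require Import mxrepresentation.
From mathcomp Require Import mpoly.
From mathcomp Require Import complex.
From mathcomp Require Import all_classical all_reals.
From mathcomp Require Import topology ereal normedtype sequences derive.
From mathcomp Require Import exp trigo measure lebesgue_measure.
From mathcomp Require Import lebesgue_integral.

Set Implicit Arguments.
Unset Strict Implicit.
Unset Printing Implicit Defensive.

Import Order.TTheory GRing.Theory Num.Theory.
Import numFieldNormedType.Exports.

Local Open Scope classical_set_scope.
Local Open Scope ring_scope.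

(* Meromorphic functions are represented by total functions whose values at poles
   (and at removable singularities) are irrelevant: two such functions are
   identified when they agree near every point, the point itself being excepted,
   i.e. off a closed discrete set. *)
Section Meromorphic.
Variable R : realType.
Local Notation C := (R[i]).
Implicit Types (f g : C -> C) (z s : C).

Definition holomorphic_at g z : Prop :=
  \forall s \near (z : C^o), derivable (g : C^o -> C^o) s 1.

Definition mero_eq f g : Prop :=
  forall z, \forall s \near (z : C^o)^', f s = g s.

Definition meromorphic f : Prop :=
  forall z, exists k : nat, exists2 g, holomorphic_at g z &
    \forall s \near (z : C^o)^', (s - z) ^+ k * f s = g s.

(* [f] is holomorphic at [z] as a meromorphic function, that is, after removing
   a possible removable singularity. *)
Definition mero_holomorphic_at f z : Prop :=
  exists2 g, holomorphic_at g z & \forall s \near (z : C^o)^', f s = g s.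

Definition mero_zero f z : Prop :=
  exists2 g, holomorphic_at g z /\ g z = 0 &
    \forall s \near (z : C^o)^', f s = g s.

(* [mero_ord f z l] : ord_{s = z} f = l, negative at poles; there is no such [l]
   when [f] vanishes identically near [z]. *)
Definition mero_ord f z (l : int) : Prop :=
  exists2 g, holomorphic_at g z /\ g z <> 0 &
    \forall s \near (z : C^o)^', f s = (s - z) ^ l * g s.

Definition cnorm z : R := complex.Re `|z|.

Definition cexp z : C :=
  (expR (complex.Re z))%:C%C
    * (cos (complex.Im z) +i* sin (complex.Im z))%C.

(* The order of growth of a meromorphic function, through its Nevanlinna
   characteristic T(r, f) = m(r, f) + N(r, f):
     m(r, f) = 1/(2 pi) \int_0^{2 pi} log^+ |f(r e^{i t})| dt,
     N(r, f) = \int_0^r (n(t, f) - n(0, f)) / t dt + n(0, f) log r,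
   where n(t, f) is the number of poles in |z| <= t, with multiplicity. *)
Definition logp (x : R) : R := ln (Num.max 1 x).

Definition pole_mult f z : nat :=
  xget 0%N [set k : nat | mero_ord f z (- k%:Z)].

Definition pole_count f (t : R) : R :=
  \sum_(z \in [set z : C | cnorm z <= t]) ((pole_mult f z)%:R : R).

Definition nevanlinna_m f (r : R) : R :=
  (2 * pi)^-1 *
  \int[lebesgue_measure]_(t in `[0, 2 * pi])
     logp (cnorm (f (r%:C%C * cexp (0 +i* t)%C))).

Definition nevanlinna_N f (r : R) : R :=
  \int[lebesgue_measure]_(t in `]0, r]) ((pole_count f t - pole_count f 0) / t)
  + pole_count f 0 * ln r.

Definition nevanlinna_T f (r : R) : R := nevanlinna_m f r + nevanlinna_N f r.

Definition mero_order f : \bar R :=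
  limf_esup (fun r : R => (logp (nevanlinna_T f r) / ln r)%:E) (pinfty_nbhs R).

(* [F], through [ev], is a field of meromorphic functions on the complex plane
   with C \subseteq F \subseteq M_{<1}.  As [F] is a field and [ev 1] is not
   zero, [ev] is automatically injective modulo [mero_eq]. *)
Record mero_field_lt1 (F : fieldType) (ev : F -> C -> C) : Prop := {
  ev_meromorphic : forall x, meromorphic (ev x);
  ev_order_lt1 : forall x, (mero_order (ev x) < 1)%E;
  ev_constants : forall c, exists x, mero_eq (ev x) (fun=> c);
  ev1 : mero_eq (ev 1) (fun=> 1);
  evD : forall x y, mero_eq (ev (x + y)) (fun s => ev x s + ev y s);
  evM : forall x y, mero_eq (ev (x * y)) (fun s => ev x s * ev y s)
}.

End Meromorphic.

Section Artin.
Variables (R : realType) (K : splittingFieldType rat).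
Local Notation C := (R[i]).
Local Notation G := ('Gal({:K} / 1)%G).

Definition ring_of_integers : set K :=
  [set x | integralOver (intr : int -> K) x].

Definition prime_ideal_over (p : nat) (P : set K) : Prop :=
  [/\ P `<=` ring_of_integers, P p%:R, ~ P 1,
      (forall x y, P x -> P y -> P (x + y)) /\
      (forall a x, ring_of_integers a -> P x -> P (a * x)) &
      forall x y, ring_of_integers x -> ring_of_integers y ->
        P (x * y) -> P x \/ P y].

(* Elements of [inertia P] and Frobenius elements stabilise [P], hence belong
   to its decomposition group: for x in P, g x is congruent to x (resp. to
   x ^+ p) modulo P. *)
Definition inertia (P : set K) : {set gal_of {:K}} :=
  finset (fun g => (g \in G) &&
    `[< forall x, ring_of_integers x -> P (g x - x) >]).

Definition frobenius (p : nat) (P : set K) (g : gal_of {:K}) : Prop :=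
  g \in G /\ forall x, ring_of_integers x -> P (g x - x ^+ p).

(* The factor det(1 - p^{-s} rho(Frob_P) | V^{I_P})^{-1}.  It depends neither on
   the prime P above p nor on the Frobenius element, so both are chosen
   arbitrarily.  Matrices act on row vectors, and the group law of [gal_of] is
   composition in the opposite order; transposing shows that neither convention
   affects characters or the value of the determinant. *)
Definition euler_factor n (rho : mx_representation C G n)
    (p : nat) (s : C) : C :=
  let P := xget set0 [set P | prime_ideal_over p P] in
  let sigma := xget 1%g [set g | frobenius p P g] in
  (\det (1%:M - cexp (- s * (ln p%:R)%:C%C) *:
           restrictmx (rfix_mx rho (inertia P)) (rho sigma)))^-1.

Definition affords n (rho : mx_representation C G n)
    (chi : gal_of {:K} -> C) : Prop :=
  forall g, chi g = \tr (rho g).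

Definition irreducible_characters : set (gal_of {:K} -> C) :=
  [set chi | exists n (rho : mx_representation C G n),
     mx_irreducible rho /\ affords rho chi].

(* [f] is L(s, chi, K / Q): the meromorphic function on the plane given by the
   Euler product for Re s > 1. *)
Definition artin_L (chi : gal_of {:K} -> C) (f : C -> C) : Prop :=
  meromorphic f /\
  exists n (rho : mx_representation C G n), affords rho chi /\
    forall s : C, 1 < complex.Re s ->
      (\prod_(0 <= p < N | prime p) euler_factor rho p s : C^o) @[N --> \oo]
        --> (f s : C^o).

End Artin.
Arguments irreducible_characters R K : clear implicits.

Definition artin_conjecture_at (R : realType) r (f : 'I_r -> R[i] -> R[i])
    (s0 : R[i]) : Prop :=
  forall j, mero_holomorphic_at (f j) s0.

Definition holo_semigroup (R : realType) r (f : 'I_r -> R[i] -> R[i])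
    (s0 : R[i]) : set 'X_{1..r} :=
  [set a : 'X_{1..r} |
     mero_holomorphic_at (fun s => \prod_(j < r) f j s ^+ a j) s0].

Section Toric.
Variables (F : fieldType) (r : nat).

Definition semigroup_algebra (H : set 'X_{1..r}) : set {mpoly F[r]} :=
  [set p | forall a, a \in msupp p -> H a].

Definition subalgebra_gen (S : set {mpoly F[r]}) : set {mpoly F[r]} :=
  smallest (fun A : set {mpoly F[r]} => GRing.subalg_closed (mem A)) S.

Definition monomials (T : set 'X_{1..r}) : set {mpoly F[r]} :=
  [set 'X_[F, a] | a in T].

Definition minimal_monomial_generators (H : set 'X_{1..r}) m
    (u : m.-tuple 'X_{1..r}) : Prop :=
  [/\ uniq u,
      subalgebra_gen (monomials [set` u]) = semigroup_algebra H &
      forall T : set 'X_{1..r}, T `<=` [set` u] ->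
        subalgebra_gen (monomials T) = semigroup_algebra H -> T = [set` u]].

Definition toric_map m (u : m.-tuple 'X_{1..r}) (t : {mpoly F[m]}) :
    {mpoly F[r]} :=
  t \mPo [tuple 'X_[F, tnth u i] | i < m].

Definition toric_ideal m (u : m.-tuple 'X_{1..r}) : set {mpoly F[m]} :=
  [set t | toric_map u t = 0].

End Toric.
Arguments semigroup_algebra F {r} H.
Arguments minimal_monomial_generators F {r} H {m} u.
Arguments toric_map F {r m} u t.
Arguments toric_ideal F {r m} u.

(* Main.v *)
Require Import Defs.
From mathcomp Require Import all_boot all_order all_algebra.
From mathcomp Require Import all_fingroup all_solvable all_field.
From mathcomp Require Import mpoly complex.
From mathcomp Require Import all_classical all_reals.
From mathcomp Require Import topology normedtype derive.
From mathcomp Require Import zify.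

Import Order.TTheory GRing.Theory Num.Theory.
Import numFieldNormedType.Exports.

Local Open Scope classical_set_scope.
Local Open Scope ring_scope.

(** The equivalence depends on the functions f_j only through their orders
    ell_j at s0: orders add up under products, and a function of order l is
    holomorphic exactly when 0 <= l and vanishes exactly when 0 < l
    ([mero_ord_prod], [mero_holomorphic_atE], [mero_zeroE]).  So H(s0) is the
    monoid of the exponents a whose weight a_1 ell_1 + ... + a_r ell_r is
    nonnegative ([halfspace]), and condition (1) says that ell_1 is the only
    positive order and divides all the others.

    The subalgebra generated by monomials is spanned by the monoid which their
    exponents generate ([subalgebra_gen_monomials]), so the exponents u_i
    generate H(s0) as a monoid and contain all its atoms
    ([atom_in_generators]).  The toric ideal vanishes if and only if no element
    of H(s0) is a combination of the u_i, with coefficients in N, in two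
    different ways ([toric_ideal_eq0P]).

    If (1) holds, write ell_j = - e_j ell_1.  Then a lies in H(s0) if and only
    if a_1 >= e_2 a_2 + ... + e_r a_r, so H(s0) is freely generated by the
    exponents of x_1 and of the x_1^(e_j) x_j ([monoid_gen_free]).  These are
    atoms ([atom_free_gen]), so by minimality they are the u_i; hence (2), and
    the description of the algebra.

    Conversely, assume (2).  In an element of weight zero, a generator of
    positive weight has coefficient zero ([comb_weight0]).  Let ell_i > 0 and
    ell_j < 0; then x_i is an atom, and v_i = x_i^(-ell_j) x_j^(ell_i) has weight
    zero, so x_i does not occur in its factorisation.
    - If ell_k > 0 for another k, let v_k = x_k^(-ell_j) x_j^(ell_k); in the
      equality
        v_i^(ell_k) x_k^(- ell_i ell_j) = v_k^(ell_i) x_i^(- ell_k ell_j)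
      the atom x_i occurs on the right but not on the left ([positive_unique]).
    - If z is the ceiling of - ell_j / ell_i, then w = x_i^z x_j is an atom and
      w^(ell_i) = v_i x_i^(z ell_i + ell_j).  As x_i does not occur on the
      left, z ell_i + ell_j = 0, and ell_i divides ell_j ([positive_dvd]). *)

(** * Orders of zeros and poles *)

Section LocalOrder.
Context {R : realType}.
Local Notation C := (R[i]).
Implicit Types (f g h : C -> C) (z : C) (l : int).

Lemma holomorphic_at_cst (c : C) z : holomorphic_at (fun=> c) z.
Proof.
rewrite /holomorphic_at; near=> s; exact: derivable_cst.
Unshelve. all: by end_near. Qed.

Lemma holomorphic_atM g h z : holomorphic_at g z -> holomorphic_at h z ->
  holomorphic_at (fun s => g s * h s) z.
Proof.
move=> hg hh; apply: filterS2 hg hh => s.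
exact: (@derivableM C C^o g h s 1).
Qed.

Lemma holomorphic_at_subX z (k : nat) : holomorphic_at (fun s => (s - z) ^+ k) z.
Proof.
elim: k => [|k IH].
  have -> : (fun s : C => (s - z) ^+ 0) = fun=> 1.
    by apply: funext => s; rewrite expr0.
  exact: holomorphic_at_cst.
have -> : (fun s : C => (s - z) ^+ k.+1) = fun s => (s - z) * (s - z) ^+ k.
  by apply: funext => s; rewrite exprS.
apply: (holomorphic_atM (fun s => s - z) _ _ _ IH).
rewrite /holomorphic_at; near=> s.
apply: (@derivableB C C^o C^o id (fun=> z) s 1); last exact: derivable_cst.
exact: derivable_id.
Unshelve. all: by end_near. Qed.

Lemma holomorphic_at_cvg g z : holomorphic_at g z ->
  (g : C^o -> C^o) s @[s --> (z : C^o)^'] --> (g z : C^o).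
Proof.
move=> /nbhs_singleton dg; apply/continuous_withinNx.
exact/differentiable_continuous/derivable1_diffP.
Qed.

(** Holomorphic functions are continuous, so their values at [z] are determined
    by their values nearby. *)
Lemma holomorphic_at_ext g h z : holomorphic_at g z -> holomorphic_at h z ->
  (\forall s \near (z : C^o)^', g s = h s) -> g z = h z.
Proof.
move=> hg hh gh.
have cg : (g : C^o -> C^o) s @[s --> (z : C^o)^'] --> (h z : C^o).
  apply: cvg_trans (holomorphic_at_cvg _ _ hh).
  by apply: near_eq_cvg; apply: filterS gh => s ->.
exact: (cvg_unique (@norm_hausdorff _ C^o) (holomorphic_at_cvg _ _ hg) cg).
Qed.

Lemma mero_ord1 z : mero_ord (fun=> 1) z 0.
Proof.
exists (fun=> 1); last by apply: nearW => s; rewrite expr0z mulr1.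
by split; [exact: holomorphic_at_cst | apply/eqP/oner_neq0].
Qed.

Lemma near_dnbhs_neq z : \forall s \near (z : C^o)^', s - z != 0.
Proof. by apply: filterS (nbhs_dnbhs_neq (z : C^o)) => s; rewrite subr_eq0. Qed.

Lemma mero_ordM f g z k l : mero_ord f z k -> mero_ord g z l ->
  mero_ord (fun s => f s * g s) z (k + l).
Proof.
move=> [f1 [hf f0] Ef] [g1 [hg g0] Eg]; exists (fun s => f1 s * g1 s).
  split; first exact: holomorphic_atM.
  by apply/eqP; rewrite mulf_neq0 //; apply/eqP.
apply: filterS3 Ef Eg (near_dnbhs_neq z) => s -> -> nz.
by rewrite expfzDr // mulrACA.
Qed.

Lemma mero_ordX f z l (a : nat) : mero_ord f z l ->
  mero_ord (fun s => f s ^+ a) z (l * a%:Z).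
Proof.
move=> hf; elim: a => [|a IH].
  rewrite mulr0; have -> : (fun s => f s ^+ 0) = fun=> 1.
    by apply: funext => s; rewrite expr0.
  exact: mero_ord1.
have -> : (fun s => f s ^+ a.+1) = fun s => f s * f s ^+ a.
  by apply: funext => s; rewrite exprS.
rewrite intS mulrDr mulr1; exact: mero_ordM.
Qed.

Lemma mero_ord_prod r (f : 'I_r -> C -> C) (ell : 'I_r -> int)
    (a : 'I_r -> nat) z :
  (forall j, mero_ord (f j) z (ell j)) ->
  mero_ord (fun s => \prod_(j < r) f j s ^+ a j) z
    (\sum_(j < r) ell j * (a j)%:Z).
Proof.
move=> hf; elim: (index_enum _) => [|j t IH].
  rewrite big_nil; have -> : (fun s => \prod_(j <- [::]) f j s ^+ a j) = fun=> 1.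
    by apply: funext => s; rewrite big_nil.
  exact: mero_ord1.
rewrite big_cons.
have -> : (fun s => \prod_(i <- j :: t) f i s ^+ a i) =
    fun s => f j s ^+ a j * \prod_(i <- t) f i s ^+ a i.
  by apply: funext => s; rewrite big_cons.
by apply: mero_ordM => //; apply: mero_ordX.
Qed.

(** If [f] has a removable singularity at [z], filled by [h], then its order is
    nonnegative, and positive if and only if [h] vanishes at [z]. *)
Lemma mero_ord_removable f h z l : mero_ord f z l -> holomorphic_at h z ->
    (\forall s \near (z : C^o)^', f s = h s) ->
  0 <= l /\ (h z = 0 <-> 0 < l).
Proof.
move=> [g [hg g0] Ef] hh Eh.
have Egh : \forall s \near (z : C^o)^', (s - z) ^ l * g s = h s.
  by apply: filterS2 Ef Eh => s <-.
case: l {Ef Eh} Egh => k Egh.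
  have /= := holomorphic_at_ext _ _ _
    (holomorphic_atM _ _ _ (holomorphic_at_subX z k) hg) hh Egh.
  rewrite subrr expr0n; case: k {Egh} => [|k] /= <-.
    by rewrite mul1r; split.
  by rewrite mul0r.
(* At a pole, [g] would be [(s - z) ^+ k.+1 * h s], which vanishes at [z]. *)
exfalso; apply: g0.
have Ehg : \forall s \near (z : C^o)^', g s = (s - z) ^+ k.+1 * h s.
  apply: filterS2 Egh (near_dnbhs_neq z) => s <- nz.
  by rewrite NegzE -exprnN mulVKf // expf_neq0.
rewrite (holomorphic_at_ext _ _ _ hg
  (holomorphic_atM _ _ _ (holomorphic_at_subX z k.+1) hh) Ehg).
by rewrite subrr exprS !mul0r.
Qed.

Lemma mero_ord_nonneg f z l : mero_ord f z l -> 0 <= l ->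
  exists h, [/\ holomorphic_at h z, \forall s \near (z : C^o)^', f s = h s &
   0 < l -> h z = 0].
Proof.
case: l => // k [g [hg g0] Ef] _; exists (fun s => (s - z) ^+ k * g s).
split; [exact: holomorphic_atM (holomorphic_at_subX z k) hg | exact: Ef |].
by case: k {Ef} => // k _; rewrite subrr exprS !mul0r.
Qed.

Lemma mero_holomorphic_atE f z l : mero_ord f z l ->
  mero_holomorphic_at f z <-> 0 <= l.
Proof.
move=> hf; split=> [[h hh Eh]|/(mero_ord_nonneg _ _ _ hf)[h [hh Eh _]]].
  by have [] := mero_ord_removable _ _ _ _ hf hh Eh.
by exists h.
Qed.

Lemma mero_zeroE f z l : mero_ord f z l -> mero_zero f z <-> 0 < l.
Proof.
move=> hf; split=> [[h [hh h0] Eh]|l0].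
  by have [_ <-] := mero_ord_removable _ _ _ _ hf hh Eh.
have [h [hh Eh h0]] := mero_ord_nonneg _ _ _ hf (ltW l0).
by exists h => //; split=> //; apply: h0.
Qed.

End LocalOrder.

(** * Submonoids of exponent vectors and monomial subalgebras *)

Section MonomialAlgebra.
Context {r : nat}.
Implicit Types (M T : set 'X_{1..r}) (a b : 'X_{1..r}).

(** Sets of exponents containing 0 and closed under addition. *)
Definition submonoid M : Prop :=
  M 0%MM /\ forall a b, M a -> M b -> M (a + b)%MM.

(** The submonoid generated by [T]. *)
Definition monoid_gen T : set 'X_{1..r} := smallest submonoid T.

Lemma submonoid_gen T : submonoid (monoid_gen T).
Proof.
split=> [M [[M0 _] _] //|a b Ma Mb M HM].
by have [[_ MD] _] := HM; apply: MD; [apply: Ma | apply: Mb].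
Qed.

Lemma submonoidMn M a k : submonoid M -> M a -> M (a *+ k)%MM.
Proof.
by move=> [M0 MD] Ma; elim: k => [|k IH]; rewrite ?mulm0n ?mulmS //; apply: MD.
Qed.

Lemma submonoid_sum M (I : Type) (s : seq I) (P : pred I)
    (a : I -> 'X_{1..r}) :
  submonoid M -> (forall i, P i -> M (a i)) -> M (\sum_(i <- s | P i) a i)%MM.
Proof. by move=> [M0 MD] Ma; elim/big_ind: _. Qed.

(** The nonzero elements of [M] that are not the sum of two nonzero elements of
    [M]. *)
Definition atom M a : Prop :=
  [/\ M a, a <> 0%MM &
      forall b c, M b -> M c -> a = (b + c)%MM -> b = 0%MM \/ c = 0%MM].

Lemma atom_in_generators T a : atom (monoid_gen T) a -> T a.
Proof.
move=> [Ma a0 a_irr].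
suff /(_ a Ma) [_] : monoid_gen T `<=` [set b | monoid_gen T b /\ (b = a -> T a)].
  exact.
apply: smallest_sub => [|b Tb]; last first.
  by split=> [|<- //]; apply: sub_gen_smallest.
split=> [|b c [Mb Hb] [Mc Hc]].
  by split=> [|a0']; [exact: (submonoid_gen T).1 | case: a0].
split=> [|bc]; first exact: (submonoid_gen T).2.
by have [b0|c0] := a_irr b c Mb Mc (esym bc);
  [apply: Hc; rewrite -bc b0 add0m | apply: Hb; rewrite -bc c0 addm0].
Qed.

Variable F : fieldType.

Lemma semigroup_algebraX M a : semigroup_algebra F M 'X_[a] <-> M a.
Proof.
split=> [|Ma b]; first by apply; rewrite msuppX inE.
by rewrite msuppX inE => /eqP ->.
Qed.

Lemma semigroup_algebra_inj M N :
  semigroup_algebra F M = semigroup_algebra F N -> M = N.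
Proof.
by move=> MN; apply/seteqP; split=> a /semigroup_algebraX; rewrite (MN, =^~ MN) =>
  /semigroup_algebraX.
Qed.

Lemma semigroup_algebra_closed M : submonoid M ->
  GRing.subalg_closed (mem (semigroup_algebra F M)).
Proof.
move=> [M0 MD]; split.
- by rewrite inE => a; rewrite -mpolyC1 msupp1 inE => /eqP ->.
- move=> c p q; rewrite !inE => Mp Mq a /msuppD_le; rewrite mem_cat.
  by case/orP=> [/msuppZ_le|]; [apply: Mp | apply: Mq].
- move=> p q; rewrite !inE => Mp Mq a /msuppM_le /allpairsP[[b c] /= [pb qc ->]].
  by apply: MD; [apply: Mp | apply: Mq].
Qed.

(** The algebra generated by the monomials with exponents in [T] is spanned by
    those with exponents in the monoid generated by [T]. *)
Lemma subalgebra_gen_monomials T :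
  subalgebra_gen (@monomials F r T) = semigroup_algebra F (monoid_gen T).
Proof.
apply/seteqP; split.
  apply: smallest_sub; first exact/semigroup_algebra_closed/submonoid_gen.
  by move=> _ [a Ta <-]; apply/semigroup_algebraX; apply: sub_gen_smallest.
move=> p Tp A [A_alg TA].
have AX : monoid_gen T `<=` [set a | A 'X_[a]].
  apply: smallest_sub => [|a Ta /=]; last by apply: TA; exists a.
  case: A_alg => A1 _ AM; split=> [|a b Aa Ab] /=.
    by rewrite mpolyX0; move: A1; rewrite inE.
  by rewrite mpolyXD; have := AM 'X_[a] 'X_[b]; rewrite !inE; apply.
have [A0 AL] := GRing.subalg_closedZ A_alg.
have {}AL c x y : A x -> A y -> A (c *: x + y).
  by have := AL c x y; rewrite !inE.
rewrite (mpolyE p) big_seq; elim/big_rec: _ => [|a q pa Aq].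
  by move: A0; rewrite inE.
by apply: (AL _ 'X_[a]) => [|//]; exact: (AX _ (Tp _ pa)).
Qed.

End MonomialAlgebra.

(** * Toric ideals and linear relations between exponents *)

Section ToricIdeal.
Context {r m : nat} (u : m.-tuple 'X_{1..r}).
Implicit Types (c d : 'X_{1..m}).

(** The combination of the exponents [u] with coefficients [c]: the exponent of
    the monomial which the toric map associates with ['X_[c]]. *)
Definition mnm_comb c : 'X_{1..r} := (\sum_i tnth u i *+ c i)%MM.

Lemma mnm_combE c j : mnm_comb c j = (\sum_i tnth u i j * c i)%N.
Proof. by rewrite /mnm_comb mnm_sumE; apply: eq_bigr => i _; rewrite mulmnE. Qed.

Lemma mnm_combD c d : mnm_comb (c + d)%MM = (mnm_comb c + mnm_comb d)%MM.
Proof.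
apply/mnmP => j; rewrite mnmDE !mnm_combE -big_split /=.
by apply: eq_bigr => i _; rewrite mnmDE mulnDr.
Qed.

Lemma mnm_combMn c k : mnm_comb (c *+ k)%MM = (mnm_comb c *+ k)%MM.
Proof.
apply/mnmP => j; rewrite mulmnE !mnm_combE big_distrl /=.
by apply: eq_bigr => i _; rewrite mulmnE mulnA.
Qed.

Lemma mnm_combU i : mnm_comb U_(i)%MM = tnth u i.
Proof.
apply/mnmP => j; rewrite mnm_combE (bigD1 i) //= mnm1E eqxx muln1 big1 ?addn0 //.
by move=> k ki; rewrite mnm1E eq_sym (negbTE ki) muln0.
Qed.

Lemma monoid_gen_comb a : monoid_gen [set` u] a -> exists c, a = mnm_comb c.
Proof.
have : monoid_gen [set` u] `<=` [set a | exists c, a = mnm_comb c].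
  apply: smallest_sub => [|_ /= /tnthP[i ->]].
    split=> [|_ _ [c ->] [d ->]]; last by exists (c + d)%MM; rewrite mnm_combD.
    by exists 0%MM; apply/mnmP => j; rewrite mnm_combE mnm0E big1 // => i _;
      rewrite mnm0E muln0.
  by exists U_(i)%MM; rewrite mnm_combU.
exact.
Qed.

Variable F : fieldType.

Lemma toric_mapX c : toric_map F u 'X_[c] = 'X_[mnm_comb c].
Proof.
rewrite /toric_map comp_mpolyX /mnm_comb.
rewrite (big_morph _ (@mpolyXD r F) (mpolyX0 r F)).
by apply: eq_bigr => i _; rewrite tnth_mktuple mpolyXn.
Qed.

(** A relation between the exponents [u] gives a binomial in the toric ideal;
    without relations, the toric map sends distinct monomials to distinct
    monomials. *)
Lemma toric_ideal_eq0P : toric_ideal F u = [set 0] <-> injective mnm_comb.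
Proof.
split=> [I0 c d cd|inj].
  have : toric_ideal F u ('X_[c] - 'X_[d]).
    have -> : toric_ideal F u ('X_[c] - 'X_[d]) =
        (toric_map F u 'X_[c] - toric_map F u 'X_[d] = 0).
      by rewrite /toric_map -comp_mpolyB.
    by rewrite !toric_mapX cd subrr.
  rewrite I0 /= => /eqP; rewrite subr_eq0 => /eqP E.
  apply/eqP; have := mcoeffX F c d; rewrite E mcoeffX eqxx.
  by case: eqP => // _ /eqP; rewrite oner_eq0.
apply/seteqP; split=> t /=; last first.
  by move=> ->; rewrite /toric_ideal /= /toric_map comp_mpoly0.
rewrite /toric_ideal /= => t0; apply/mpolyP => d; rewrite mcoeff0.
have := congr1 (mcoeff (mnm_comb d)) t0; rewrite mcoeff0 => <-.
rewrite /toric_map comp_mpolyEX {1}(mpolyE t) !raddf_sum /=.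
apply: eq_bigr => c _; rewrite !mcoeffZ mcoeffX; congr (_ * _).
by rewrite -/(toric_map F u 'X_[c]) toric_mapX mcoeffX (inj_eq inj).
Qed.

End ToricIdeal.

(** * Half-spaces of exponent vectors *)

Section HalfSpace.
Context {r : nat} (ell : 'I_r -> int).
Implicit Types (a b : 'X_{1..r}).

(** The linear form with coefficients [ell].  When [ell] gives the orders of
    functions f_j, [weight a] is the order of the product of the f_j^(a_j). *)
Definition weight a : int := \sum_j ell j * (a j)%:Z.

(** The exponents of nonnegative weight. *)
Definition halfspace : set 'X_{1..r} := [set a | 0 <= weight a].

Lemma weightD a b : weight (a + b)%MM = weight a + weight b.
Proof.
by rewrite /weight -big_split; apply: eq_bigr => j _; rewrite mnmDE PoszD mulrDr.
Qed.

Lemma weight0 : weight 0%MM = 0.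
Proof. by rewrite /weight big1 // => j _; rewrite mnm0E mulr0. Qed.

Lemma weightMn a k : weight (a *+ k)%MM = weight a * k%:Z.
Proof.
rewrite /weight big_distrl; apply: eq_bigr => j _.
by rewrite mulmnE PoszM mulrA.
Qed.

Lemma weightU j : weight U_(j)%MM = ell j.
Proof.
rewrite /weight (bigD1 j) //= mnm1E eqxx mulr1 big1 ?addr0 // => k kj.
by rewrite mnm1E eq_sym (negbTE kj) mulr0.
Qed.

Lemma weight_comb m (u : m.-tuple 'X_{1..r}) c :
  weight (mnm_comb u c) = \sum_i weight (tnth u i) * (c i)%:Z.
Proof.
rewrite /mnm_comb (big_morph _ weightD weight0).
by apply: eq_bigr => i _; rewrite weightMn.
Qed.

Lemma submonoid_halfspace : submonoid halfspace.
Proof.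
split=> [|a b]; rewrite /halfspace /= ?weight0 // weightD; exact: addr_ge0.
Qed.

Lemma atomU j : 0 <= ell j -> atom halfspace U_(j)%MM.
Proof.
move=> ell_j; split=> [|/eqP|b c _ _ /(congr1 mdeg)].
- by rewrite /halfspace /= weightU.
- by rewrite -mdeg_eq0 mdeg1.
rewrite mdegD mdeg1 => /esym/eqP; rewrite addn_eq1.
by case/orP=> /andP[E1 E2]; [right|left]; apply/eqP; rewrite -mdeg_eq0.
Qed.

(** If [k] is the least exponent for which x_i^k x_j has nonnegative weight, no
    positive power of x_i can be split off. *)
Lemma atom_minimal i j (k : nat) : i != j -> 0 <= ell i * k%:Z + ell j ->
    (forall k' : nat, 0 <= ell i * k'%:Z + ell j -> (k <= k')%N) ->
  atom halfspace (U_(i) *+ k + U_(j))%MM.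
Proof.
move=> ij ell_k k_min.
have aE l : (U_(i) *+ k + U_(j))%MM l = ((i == l) * k + (j == l))%N.
  by rewrite mnmDE mulmnE !mnm1E.
(* The summand [b] is the one that contains [U_(j)]. *)
have main b c : halfspace b -> (U_(i) *+ k + U_(j))%MM = (b + c)%MM ->
    c j = 0%N -> c = 0%MM.
  move=> Hb abc cj.
  have bcE l : ((i == l) * k + (j == l) = b l + c l)%N by rewrite -aE abc mnmDE.
  have bE : b = (U_(i) *+ b i + U_(j))%MM.
    apply/mnmP => l; rewrite mnmDE mulmnE !mnm1E.
    have := bcE l; have := bcE j; rewrite eqxx (negbTE ij) cj.
    case: (eqVneq i l) => [<-|_]; first by rewrite eq_sym (negbTE ij); lia.
    by case: (eqVneq j l) => [<-|_]; lia.
  have kb : (k <= b i)%N.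
    apply: k_min; move: Hb; rewrite /halfspace /= {1}bE weightD weightMn !weightU.
    exact.
  apply/mnmP => l; rewrite mnm0E; have := bcE l; have := bcE j.
  rewrite eqxx (negbTE ij).
  case: (eqVneq i l) => [<-|_]; last first.
    by case: (eqVneq j l) => [<-|_]; rewrite ?cj //; lia.
  by rewrite eq_sym (negbTE ij); lia.
split=> [|/mnmP/(_ j)|b c Hb Hc abc].
- by rewrite /halfspace /= weightD weightMn !weightU.
- by rewrite aE mnm0E eqxx addn1.
have : (b j + c j = 1)%N by rewrite -mnmDE -abc aE eqxx (negbTE ij).
move/eqP; rewrite addn_eq1 => /orP[] /andP[/eqP bj /eqP cj].
  by right; apply: (main b).
by left; apply: (main c) => //; rewrite abc addmC.
Qed.

End HalfSpace.

(** * Half-spaces whose generators satisfy no relation *)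

Section TrivialToricIdeal.
Context {r m : nat} (ell : 'I_r -> int) (u : m.-tuple 'X_{1..r}).
Hypothesis u_gen : monoid_gen [set` u] = halfspace ell.
Hypothesis u_inj : injective (mnm_comb u).

Lemma atom_tnth a : atom (halfspace ell) a -> exists k, a = tnth u k.
Proof. by rewrite -u_gen => /atom_in_generators /= /tnthP. Qed.

Lemma halfspace_comb a : halfspace ell a -> exists c, a = mnm_comb u c.
Proof. by rewrite -u_gen; apply: monoid_gen_comb. Qed.

(** All generators have nonnegative weight, so only those of weight zero occur
    in an element of weight zero. *)
Lemma comb_weight0 c k : weight ell (mnm_comb u c) = 0 ->
  0 < weight ell (tnth u k) -> c k = 0%N.
Proof.
rewrite weight_comb => /psumr_eq0P H0 uk.
have H i : 0 <= weight ell (tnth u i).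
  have : halfspace ell (tnth u i); last exact.
  by rewrite -u_gen; apply: sub_gen_smallest; rewrite /= mem_tnth.
have /eqP := H0 (fun i _ => mulr_ge0 (H i) (le0z_nat _)) k isT.
by rewrite mulf_eq0 gt_eqF //= => /eqP [].
Qed.

(** In the presence of a negative coefficient, at most one coefficient is
    positive. *)
Lemma positive_unique i i' j : 0 < ell i -> 0 < ell i' -> ell j < 0 -> i = i'.
Proof.
move=> pi pi' nj; apply/eqP/negPn/negP => ii'.
have [k uk] := atom_tnth _ (atomU ell i (ltW pi)).
have [k' uk'] := atom_tnth _ (atomU ell i' (ltW pi')).
have kk' : k' != k.
  apply: contraNneq ii' => kk; rewrite -(@eq_mnm1 r).
  by rewrite uk uk' kk.
set x := `|ell i|%N; set x' := `|ell i'|%N; set y := `|ell j|%N.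
have [vi vi'] : weight ell (U_(i) *+ y + U_(j) *+ x)%MM = 0 /\
    weight ell (U_(i') *+ y + U_(j) *+ x')%MM = 0.
  by rewrite !weightD !weightMn !weightU /x /x' /y; split; nia.
have [c cE] : exists c, (U_(i) *+ y + U_(j) *+ x)%MM = mnm_comb u c.
  by apply: halfspace_comb; rewrite /halfspace /= vi.
have [c' c'E] : exists c, (U_(i') *+ y + U_(j) *+ x')%MM = mnm_comb u c.
  by apply: halfspace_comb; rewrite /halfspace /= vi'.
have ck : c k = 0%N by apply: comb_weight0; rewrite -?cE // -uk weightU.
have E : (c *+ x' + U_(k') *+ (x * y) = c' *+ x + U_(k) *+ (x' * y))%MM.
  apply: u_inj; rewrite !mnm_combD !mnm_combMn -cE -c'E !mnm_combU -uk -uk'.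
  by apply/mnmP => l; rewrite !(mnmDE, mulmnE); lia.
have /mnmP/(_ k) := E; rewrite !(mnmDE, mulmnE) !mnm1E ck eqxx (negbTE kk').
have : (0 < x' * y)%N by rewrite /x' /y; nia.
lia.
Qed.

Lemma positive_dvd i j : 0 < ell i -> ell j < 0 -> (ell i %| ell j)%Z.
Proof.
move=> pi nj.
have [k uk] := atom_tnth _ (atomU ell i (ltW pi)).
have ij : i != j by apply/eqP => ij; move: pi; rewrite ij; lia.
set x := `|ell i|%N; set y := `|ell j|%N.
have x0 : (0 < x)%N by rewrite /x; lia.
(* The ceiling of [y / x], the least exponent allowed by [atom_minimal]. *)
pose z := ((y + x.-1) %/ x)%N.
have yz : (y <= x * z)%N.
  have := divn_eq (y + x.-1) x; have := ltn_pmod (y + x.-1) x0.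
  by rewrite -/z; lia.
have [k' uk'] : exists k', (U_(i) *+ z + U_(j))%MM = tnth u k'.
  apply: atom_tnth; apply: atom_minimal => //; first by rewrite /x /y in yz *; lia.
  move=> t Ht; have yt : (y <= t * x)%N by rewrite /x /y; lia.
  by rewrite /z -ltnS ltn_divLR //; lia.
have kk' : k' != k.
  apply/eqP => kk; have : U_(i)%MM j = (U_(i) *+ z + U_(j))%MM j.
    by rewrite uk' kk -uk.
  by rewrite mnmDE mulmnE !mnm1E eqxx (negbTE ij).
have v0 : weight ell (U_(i) *+ y + U_(j) *+ x)%MM = 0.
  by rewrite !weightD !weightMn !weightU /x /y; nia.
have [c cE] : exists c, (U_(i) *+ y + U_(j) *+ x)%MM = mnm_comb u c.
  by apply: halfspace_comb; rewrite /halfspace /= v0.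
have ck : c k = 0%N by apply: comb_weight0; rewrite -?cE // -uk weightU.
have E : (U_(k') *+ x = c + U_(k) *+ (x * z - y))%MM.
  apply: u_inj; rewrite !mnm_combD !mnm_combMn -cE !mnm_combU -uk -uk'.
  by apply/mnmP => l; rewrite !(mnmDE, mulmnE); nia.
have /mnmP/(_ k) := E; rewrite !(mnmDE, mulmnE) !mnm1E ck eqxx (negbTE kk').
move=> E'; have {E'} yE : y = (x * z)%N by lia.
by rewrite dvdzE -/x -/y yE dvdn_mulr.
Qed.

End TrivialToricIdeal.

(** * Half-spaces that are free monoids *)

Section FreeHalfSpace.
Context {n : nat} (ell : 'I_n.+1 -> int) (e : 'I_n.+1 -> nat).
Hypothesis ell0 : 0 < ell ord0.
Hypothesis ellE : forall j, j != ord0 -> ell j = - ((e j)%:Z * ell ord0).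

(** The exponents of x_0 (for [j = ord0], whatever [e ord0] may be) and of
    x_0^(e_j) x_j. *)
Definition free_gen j : 'X_{1..n.+1} :=
  if j == ord0 then U_(ord0)%MM else (U_(ord0) *+ e j + U_(j))%MM.

Lemma free_genE j l : l != ord0 -> free_gen j l = (j == l).
Proof.
move=> l0; rewrite /free_gen; case: eqP => [->|_]; first by rewrite mnm1E.
by rewrite mnmDE mulmnE !mnm1E eq_sym (negbTE l0).
Qed.

Lemma halfspace_freeE a : halfspace ell a <->
  (\sum_(j < n.+1 | j != ord0) e j * a j <= a ord0)%N.
Proof.
have -> : halfspace ell a <-> 0 <= weight ell a by [].
have -> : weight ell a = ell ord0 *
    ((a ord0)%:Z - (\sum_(j < n.+1 | j != ord0) e j * a j)%N%:Z).
  rewrite /weight (bigD1 ord0) //= mulrBr; congr (_ + _).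
  rewrite (big_morph Posz PoszD (erefl _)) mulr_sumr -sumrN.
  by apply: eq_bigr => j j0; rewrite ellE // PoszM mulNr mulrA [ell ord0 * _]mulrC.
by rewrite pmulr_rge0 // subr_ge0 lez_nat.
Qed.

Lemma atom_free_gen j : atom (halfspace ell) (free_gen j).
Proof.
rewrite /free_gen; case: eqVneq => [_|j0]; first exact/atomU/ltW.
apply: atom_minimal; rewrite 1?eq_sym // (ellE _ j0); first by rewrite mulrC subrr.
by move=> k'; rewrite mulrC -mulrBl pmulr_lge0 // subr_ge0 lez_nat.
Qed.

Lemma monoid_gen_free : monoid_gen (range free_gen) = halfspace ell.
Proof.
apply/seteqP; split.
  apply: smallest_sub; first exact: submonoid_halfspace.
  by move=> _ [j _ <-]; case: (atom_free_gen j).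
move=> a /halfspace_freeE Ha.
have M := submonoid_gen (range free_gen).
have Mj j : monoid_gen (range free_gen) (free_gen j).
  by apply: sub_gen_smallest; exists j.
(* [a] is the combination with coefficients [a j] for [j != ord0], and the rest
   of the coordinate [ord0] on x_0. *)
set s := (\sum_(_ < _ | _) _)%N in Ha.
have -> : a = (free_gen ord0 *+ (a ord0 - s) +
               \sum_(j < n.+1 | j != ord0) free_gen j *+ a j)%MM.
  apply/mnmP => l; rewrite mnmDE mulmnE mnm_sumE.
  case: (eqVneq l ord0) => [->|l0].
    rewrite {1}/free_gen eqxx mnm1E eqxx mul1n -[LHS](subnK Ha); congr addn.
    apply: eq_bigr => j j0; rewrite mulmnE /free_gen (negbTE j0) mnmDE mulmnE.
    by rewrite !mnm1E eqxx (negbTE j0) mul1n addn0.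
  rewrite free_genE // eq_sym (negbTE l0) mul0n add0n (bigD1 l) //=.
  rewrite mulmnE free_genE // eqxx mul1n big1 ?addn0 // => j /andP[_ jl].
  by rewrite mulmnE free_genE // (negbTE jl).
apply: M.2; first exact: (submonoidMn _ _ _ M (Mj _)).
by apply: (submonoid_sum _ _ _ _ _ M) => j _; apply: (submonoidMn _ _ _ M (Mj _)).
Qed.

Context {m : nat} (u : m.-tuple 'X_{1..n.+1}).
Hypothesis u_uniq : uniq u.
Hypothesis u_range : [set` u] = range free_gen.

(** The coefficient of x_0^(e_j) x_j is read on the coordinate [j]; that of x_0 is
    then read on the coordinate [ord0]. *)
Lemma mnm_comb_free_inj : injective (mnm_comb u).
Proof.
have /choice[s sE] i : exists j, tnth u i = free_gen j.
  have : [set` u] (tnth u i) by rewrite /= mem_tnth.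
  by rewrite u_range => -[j _ <-]; exists j.
have s_inj : injective s.
  by move=> i j ij; apply: (tuple_uniqP _ u_uniq); rewrite !sE ij.
move=> c d cd.
have cd1 i : s i != ord0 -> c i = d i.
  have H b : s i != ord0 -> mnm_comb u b (s i) = b i.
    move=> si; rewrite mnm_combE (bigD1 i) //= sE free_genE // eqxx mul1n.
    rewrite big1 ?addn0 // => k ki.
    by rewrite sE free_genE // (inj_eq s_inj) (negbTE ki).
  by move=> si; rewrite -(H c) // -(H d) // cd.
apply/mnmP => i; case: (eqVneq (s i) ord0) => [si|]; last exact: cd1.
have := congr1 (fun a : 'X_{1..n.+1} => a ord0) cd; rewrite !mnm_combE.
rewrite (bigD1 i) //= [RHS](bigD1 i) //= sE si /free_gen eqxx mnm1E eqxx !mul1n.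
rewrite [X in (_ + X)%N = _](eq_bigr (fun k => tnth u k ord0 * d k)%N).
  exact: addIn.
by move=> k ki; rewrite cd1 // -si (inj_eq s_inj).
Qed.

End FreeHalfSpace.

(** * The equivalence *)

(* There is always at least one irreducible character, so their number is
   written [n.+1]; the informal index j corresponds to the ordinal j - 1. *)
Theorem theorem1p4 (R : realType) (K : splittingFieldType rat)
    (galK : galois 1 {:K})
    (n : nat) (chi : 'I_n.+1 -> gal_of {:K} -> R[i])
    (chi_irr : set_bij [set: 'I_n.+1] (irreducible_characters R K) chi)
    (f : 'I_n.+1 -> R[i] -> R[i])
    (f_artin : forall j, artin_L (chi j) (f j))
    (s0 : R[i]) (s0_neq1 : s0 <> 1)
    (ell : 'I_n.+1 -> int)
    (ell_ord : forall j, mero_ord (f j) s0 (ell j))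
    (F : fieldType) (ev : F -> R[i] -> R[i])
    (F_mero : mero_field_lt1 ev)
    (m : nat) (u : m.-tuple 'X_{1..n.+1})
    (u_min : minimal_monomial_generators F (holo_semigroup f s0) u)
    (not_artin : ~ artin_conjecture_at f s0)
    (p q : nat) (p_ge1 : (1 <= p)%N) (p_lt_q : (p < q)%N)
    (q_le_r : (q <= n.+1)%N)
    (ell_pos : forall j : 'I_n.+1, (j < p)%N -> 0 < ell j)
    (ell_neg : forall j : 'I_n.+1, (p <= j < q)%N -> ell j < 0)
    (ell_zero : forall j : 'I_n.+1, (q <= j)%N -> ell j = 0) :
  let cond1 :=
    [/\ mero_zero (f ord0) s0,
        forall j : 'I_n.+1, j != ord0 -> ~ mero_zero (f j) s0 &
        forall j : 'I_n.+1, j != ord0 -> (ell ord0 %| ell j)%Z] in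
  let cond2 := toric_ideal F u = [set 0] in
  (cond1 <-> cond2) /\
  (cond1 \/ cond2 ->
     exists (q' : nat) (e : 'I_n.+1 -> nat),
       [/\ (2 <= q' <= n.+1)%N,
           forall j : 'I_n.+1, (1 <= j < q')%N ->
             (e j)%:R = - ((ell j)%:~R / (ell ord0)%:~R) :> rat &
           semigroup_algebra F (holo_semigroup f s0) =
           subalgebra_gen
             ([set 'X_ord0] `|`
              [set 'X_ord0 ^+ e j * 'X_j
                 | j in [set j : 'I_n.+1 | (1 <= j < q')%N]] `|`
              [set 'X_j | j in [set j : 'I_n.+1 | (q' <= j)%N]])]).
Proof.
move=> cond1 cond2.
have HE : holo_semigroup f s0 = halfspace ell.
  by apply/seteqP; split=> a;
    rewrite /holo_semigroup /= (mero_holomorphic_atE _ _ _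
      (mero_ord_prod _ _ ell a _ ell_ord)).
case: u_min => u_uniq u_gen u_minimal; rewrite HE in u_gen u_minimal *.
have gen : monoid_gen [set` u] = halfspace ell.
  by apply: (semigroup_algebra_inj F); rewrite -subalgebra_gen_monomials.
have zeroE j : mero_zero (f j) s0 <-> 0 < ell j := mero_zeroE _ _ _ (ell_ord j).
have ell0 : 0 < ell ord0 := ell_pos ord0 p_ge1.
have [jn ell_jn] : exists j, ell j < 0.
  have pn := leq_trans p_lt_q q_le_r.
  by exists (Ordinal pn); apply: ell_neg; rewrite /= leqnn.
pose e j := `|(ell j %/ ell ord0)%Z|%N.
have ellE : cond1 -> forall j, j != ord0 -> ell j = - ((e j)%:Z * ell ord0).
  move=> [_ nz dv] j j0; have ej := divzK (dv j j0).
  have lj : ~ 0 < ell j by rewrite -zeroE; apply: nz.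
  have d0 : (ell j %/ ell ord0)%Z <= 0.
    by rewrite -(pmulr_lle0 _ ell0) ej leNgt; apply/negP.
  have -> : (e j)%:Z = - (ell j %/ ell ord0)%Z by rewrite /e abszE ler0_norm.
  by rewrite mulNr opprK ej.
have equiv : cond1 <-> cond2.
  rewrite /cond2 toric_ideal_eq0P; split=> [/ellE {}ellE|u_inj].
    apply: (mnm_comb_free_inj e) => //; apply/esym/u_minimal.
      by move=> _ [j _ <-]; apply: atom_in_generators; rewrite gen;
        apply: atom_free_gen.
    by rewrite subalgebra_gen_monomials (monoid_gen_free ell).
  have le0 j : j != ord0 -> ~ 0 < ell j.
    by move=> /eqP j0 lj; apply/j0/(positive_unique ell u gen u_inj _ _ jn).
  split=> [|j j0|j j0]; first exact/zeroE.
    by rewrite zeroE; apply: le0.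
  case: (ltgtP (ell j) 0) => [lj|lj|->]; last exact: dvdz0.
    exact: (positive_dvd ell u gen u_inj).
  by case: (le0 j j0).
split=> // c12; have {c12} /ellE {}ellE : cond1 by case: c12 => // /equiv.
(* The bound [q] of the ordering also serves as [q']. *)
exists q, e; split; first by rewrite q_le_r andbT; lia.
  move=> j /andP[j1 _]; have j0 : j != ord0 by rewrite -lt0n.
  rewrite (ellE j j0) rmorphN rmorphM /= mulNr opprK mulfK //.
  by rewrite intr_eq0 gt_eqF.
rewrite -(monoid_gen_free ell e) // -subalgebra_gen_monomials.
have gE j : j != ord0 -> 'X_[F, free_gen e j] = 'X_ord0 ^+ e j * 'X_j.
  by move=> j0; rewrite /free_gen (negbTE j0) mpolyXD mpolyXn.
have gq (j : 'I_n.+1) : (q <= j)%N -> 'X_[F, free_gen e j] = 'X_j.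
  move=> qj; have j0 : j != ord0 by rewrite -lt0n; apply: leq_trans qj; lia.
  by rewrite gE // /e (ell_zero j qj) div0z expr0 mul1r.
congr subalgebra_gen; apply/seteqP; split.
  move=> _ [_ [j _ <-] <-]; case: (eqVneq j ord0) => [->|j0].
    by left; left; rewrite /free_gen eqxx.
  case: (leqP q j) => qj; first by right; exists j => //; rewrite gq.
  by left; right; exists j; rewrite ?gE //= qj andbT lt0n.
move=> _ [[->|[j /= /andP[j1 _] <-]]|[j /= qj <-]].
- by exists (free_gen e ord0); [exists ord0 | rewrite /free_gen eqxx].
- by exists (free_gen e j); [exists j | rewrite gE // -lt0n].
- by exists (free_gen e j); [exists j | rewrite gq].
Qed.
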